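(* Let $S\subset[0,1]$ be a Borel subset. Then exactly one of the following two assertions holds: (1) there exists a $\phi\in\mathcal{H}$ such that $\phi(S)$ is FAP; (2) $\phi(S)$ is RAP for every $\phi\in\mathcal{H}$. Moreover, (1) holds if and only if $S$ is meager.
   Context: $\mathcal{H}$ denotes the set of homeomorphisms $\phi\colon[0,1]\to[0,1]$ (of the unit interval onto itself). An arithmetic progression (AP) is a finite strictly increasing sequence in $\mathbb{R}$ of the form $(x+kd)_{k=0}^{n-1}$ with step $d>0$ and length $n\geq 3$; it is identified with the set of its elements. A set $S\subset\mathbb{R}$ is FAP if it contains no $3$-term APs. A set $S\subset\mathbb{R}$ is RAP if it contains APs of arbitrarily large finite length. A set $S\subset\mathbb{R}$ is nowhere dense if its closure in $\mathbb{R}$ has empty interior, and meager if it is a countable union of nowhere dense sets. *)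

(* Defs.v *)
From mathcomp Require Import all_boot all_order all_algebra.
From mathcomp Require Import all_classical all_reals all_analysis.
Import Order.TTheory GRing.Theory Num.Theory.
Import numFieldNormedType.Exports.

Set Implicit Arguments.
Unset Strict Implicit.
Unset Printing Implicit Defensive.

Local Open Scope classical_set_scope.
Local Open Scope ring_scope.

(* A homeomorphism of [0, 1] is represented by a total function on R of which
   only the restriction to [0, 1] is constrained; g is its inverse. *)
Definition unit_homeo (R : realType) (phi : R -> R) : Prop :=
  [/\ set_bij `[0, 1] `[0, 1] phi,
      {within `[0, 1], continuous phi} &
      exists g : R -> R,
        {in `[0, 1], cancel phi g} /\ {within `[0, 1], continuous g}].

Definition arith_prog (R : realType) (n : nat) (P : set R) : Prop :=
  (3 <= n)%N /\
  exists x d : R, 0 < d /\ P = [set x + k%:R * d | k in `I_n].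

Definition has_AP (R : realType) (n : nat) (S : set R) : Prop :=
  exists P : set R, arith_prog n P /\ P `<=` S.

Definition FAP (R : realType) (S : set R) : Prop := ~ has_AP 3 S.

Definition RAP (R : realType) (S : set R) : Prop :=
  forall N : nat, exists n : nat, (N <= n)%N /\ has_AP n S.

Definition nowhere_dense (R : realType) (S : set R) : Prop :=
  (closure S)° = set0.

(* Finite unions are covered, since set0 is nowhere dense. *)
Definition meager (R : realType) (S : set R) : Prop :=
  exists F : nat -> set R,
    (forall n, nowhere_dense (F n)) /\ S = \bigcup_n F n.

Definition borel (R : realType) (S : set R) : Prop :=
  <<s [set U : set R | open U] >> S.

(* Main.v *)
Require Import Defs.
From mathcomp Require Import all_boot all_order all_algebra.
From mathcomp Require Import all_classical all_reals all_analysis.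
From mathcomp Require Import ring lra zify.
Import Order.TTheory GRing.Theory Num.Theory.
Import numFieldNormedType.Exports.

(** Everything follows from two facts about a subset [S] of the unit interval.

    If [S] is Borel and not meager, then [phi @` S] is RAP for every
    homeomorphism [phi] ([nonmeager_RAP]). A Borel set has the Baire property
    ([borel_baire_property]), so [S] is comeager in some interval. A
    homeomorphism of the unit interval is monotone and preserves meagerness
    ([meager_homeo]), so [phi @` S] is comeager in some interval as well. In
    such an interval one may fix a small step and then choose the starting point
    of a progression of any given length outside a meager set
    ([comeager_RAP]).

    If [S] is meager, then [phi @` S] is FAP for some homeomorphism [phi]
    ([meager_FAP]). Generic increasing homeomorphisms have this property. A
    nowhere dense set can be sent to a finite set of levels by a function
    uniformly close to any given nondecreasing continuous one: a staircase that
    rises only in gaps of the set. The levels can be moved slightly so that no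
    three of them form a progression, and at any fixed scale this survives
    small uniform perturbations ([perturb_separates]). Iterating along an
    increasing sequence of nowhere dense sets that exhausts [S], with scales and
    perturbations tending to zero, produces in the limit a strictly increasing
    function with no three-term progression in the image of [S]
    ([limit_of_perturbations]). Staircases are not injective, so the iteration
    stays among nondecreasing functions, and strict monotonicity is one more
    condition obtained scale by scale.

    The two cases exclude each other because a RAP set contains a progression
    of length at least three, hence one of length exactly three. *)

Set Implicit Arguments.
Unset Strict Implicit.
Unset Printing Implicit Defensive.

Local Open Scope classical_set_scope.
Local Open Scope ring_scope.

(** * Meager sets and the Baire property *)

Section category.
Context {R : realType}.
Implicit Types (S F M U : set R) (a b x : R).

Lemma nbhs_itvoo a b x : a < x < b -> nbhs x (`]a, b[%classic : set R).
Proof.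
by move=> xab; apply: open_nbhs_nbhs; split; [exact: itv_open|rewrite /= in_itv].
Qed.

(** Having gaps everywhere is the form in which nowhere density is used: it
    survives translations, finite unions and monotone maps with no appeal to
    closures. *)
Lemma nowhere_denseP S : nowhere_dense S <->
  forall a b, a < b ->
    exists l r, [/\ a < l, l < r, r < b & forall x, l <= x <= r -> ~ S x].
Proof.
split=> [Snd a b ab|Sgap].
- have [x [/= xab nSx]] : exists x, a < x < b /\ ~ closure S x.
    apply/not_existsP => nx.
    suff : (closure S)° ((a + b) / 2) by rewrite Snd.
    apply: filterS (@nbhs_itvoo a b _ _); last lra.
    move=> x; rewrite /= in_itv /= => xab.
    by apply: contrapT => nSx; apply: (nx x).
  have : nbhs x (`]a, b[ `&` ~` closure S).
    apply: filterI; first exact: nbhs_itvoo.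
    by apply: open_nbhs_nbhs; split=> //; exact/closed_openC/closed_closure.
  move=> /nbhs_ballP[e /= e0 xe].
  exists (x - e / 2), (x + e / 2).
  have sub y : x - e / 2 <= y <= x + e / 2 -> (`]a, b[ `&` ~` closure S) y.
    move=> xy; apply: xe; rewrite /ball /= ltr_norml; lra.
  have [+ _] := sub (x - e / 2) ltac:(lra).
  have [+ _] := sub (x + e / 2) ltac:(lra).
  rewrite /= !in_itv /= => /andP[_ ?] /andP[? _]; split => //; first lra.
  by move=> y /sub[_ nSy] /subset_closure.
- rewrite /nowhere_dense -subset0 => x /nbhs_ballP[e /= e0 xe].
  have [l [r [xl lr rx nS]]] := Sgap (x - e) (x + e) ltac:(lra).
  have /xe/(_ `]l, r[%classic)[] : ball x e ((l + r) / 2).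
    by rewrite /ball /= ltr_norml; lra.
  + by apply: nbhs_itvoo; lra.
  + move=> y [Sy]; rewrite /= in_itv /= => ylr.
    by apply: (nS y _ Sy); lra.
Qed.

Lemma nowhere_dense_subset S F : S `<=` F -> nowhere_dense F -> nowhere_dense S.
Proof.
move=> SF /nowhere_denseP Fgap; apply/nowhere_denseP => a b /Fgap[l [r [? ? ? n]]].
by exists l, r; split => // x /n nF /SF.
Qed.

Lemma nowhere_dense0 : nowhere_dense (@set0 R).
Proof. by rewrite /nowhere_dense closure0 interior0. Qed.

Lemma nowhere_dense_shift S x : nowhere_dense S -> nowhere_dense [set y | S (y + x)].
Proof.
move=> /nowhere_denseP Sgap; apply/nowhere_denseP => a b ab.
have [l [r [? ? ? nS]]] := Sgap (a + x) (b + x) ltac:(lra).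
exists (l - x), (r - x); split; [lra..|] => y ylr; apply: nS; lra.
Qed.

Lemma meagerP S : meager S <->
  exists2 F : nat -> set R, (forall n, nowhere_dense (F n)) & S `<=` \bigcup_n F n.
Proof.
split=> [[F [Fnd ->]]|[F Fnd SF]]; first by exists F.
exists (fun n => F n `&` S); split => [n|].
  by apply: (nowhere_dense_subset _ (Fnd n)); exact: subIsetl.
by rewrite -setI_bigcupl; apply/esym/setIidPr.
Qed.

Lemma meager_subset S M : S `<=` M -> meager M -> meager S.
Proof.
by move=> SM /meagerP[F Fnd MF]; apply/meagerP; exists F => //; exact: subset_trans MF.
Qed.

Lemma nowhere_dense_meager S : nowhere_dense S -> meager S.
Proof. by move=> Snd; apply/meagerP; exists (fun=> S) => // x Sx; exists 0%N. Qed.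

Lemma meager_bigcup (M : nat -> set R) :
  (forall n, meager (M n)) -> meager (\bigcup_n M n).
Proof.
move=> /choice[F FP].
apply/meagerP; exists (fun n => oapp (fun p => F p.1 p.2) set0 (unpickle n)) => [n|x].
- case: (unpickle n) => [p|] /=; first by have [] := FP p.1.
  exact: nowhere_dense0.
- move=> [n _]; have [_ ->] := FP n => -[k _ Fx].
  by exists (pickle (n, k)) => //=; rewrite pickleK.
Qed.

Lemma meagerU S M : meager S -> meager M -> meager (S `|` M).
Proof.
move=> mS mM; rewrite -bigcup2E; apply: meager_bigcup => -[|[|n]] //=.
exact/nowhere_dense_meager/nowhere_dense0.
Qed.

Lemma Baire_itv M a b : meager M -> a < b -> exists2 x, a < x < b & ~ M x.
Proof.
move=> [F [Fnd ->]] ab.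
have : dense (\bigcap_n ~` closure (F n)).
  apply: (@Baire R R) => n; split; first exact/closed_openC/closed_closure.
  move=> O [x Ox] Oop; apply: contrapT => /set0P/negP/negPn/eqP/disjoints_subset.
  rewrite setCK => OF.
  have : (closure (F n))° x by apply: filterS OF _; exact: open_nbhs_nbhs.
  by rewrite Fnd.
move=> /(_ `]a, b[%classic)[| |x []].
- by exists ((a + b) / 2); rewrite /= in_itv /= midf_lt// midf_lt.
- exact: itv_open.
rewrite /= in_itv /= => xab nF; exists x => // -[n _ /subset_closure].
exact: nF.
Qed.

Definition baire_property S :=
  exists U, [/\ open U, meager (S `\` U) & meager (U `\` S)].

(** The sets with the Baire property form a sigma-algebra containing the open
    sets. For complements: if [B] is an open [U] up to a meager set, then
    [~` B] is the closed set [~` U] up to a meager set, hence also its interior,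
    because the boundary of an open set is nowhere dense. *)
Lemma borel_baire_property S : borel S -> baire_property S.
Proof.
have meager0 : meager (@set0 R) := nowhere_dense_meager nowhere_dense0.
apply: smallest_sub; last first.
  by move=> U Uop; exists U; rewrite setDv; split.
split.
- by exists set0; rewrite setDv; split => //; exact: open0.
- move=> B [U [Uop mBU mUB]].
  exists (~` U)°; split; first exact: open_interior.
  + have bnd : nowhere_dense (~` U `\` (~` U)°).
      apply/nowhere_denseP => a b ab.
      have [[x /= xab Ux]|nU] := pselect (exists2 x, `]a, b[%classic x & U x).
        have /nbhs_ballP[e /= e0 xe] : nbhs x (`]a, b[ `&` U).
          apply: open_nbhs_nbhs; split=> //.
          by apply: openI => //; exact: itv_open.
        have sub y : x - e / 2 <= y <= x + e / 2 -> (`]a, b[ `&` U) y.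
          move=> xy; apply: xe; rewrite /ball /= ltr_norml; lra.
        have [+ _] := sub (x - e / 2) ltac:(lra).
        have [+ _] := sub (x + e / 2) ltac:(lra).
        rewrite /= !in_itv /= => /andP[_ ?] /andP[? _].
        exists (x - e / 2), (x + e / 2); split => //; first lra.
        by move=> y /sub[_ Uy] [].
      exists (a + (b - a) / 3), (a + 2 * (b - a) / 3); split; [lra..|].
      move=> y ylr [_]; apply; apply: filterS (@nbhs_itvoo a b _ _); last lra.
      by move=> z zab Uz; apply: nU; exists z.
    apply: (meager_subset _ (meagerU mUB (nowhere_dense_meager bnd))).
    move=> x [[_ nBx]] nix; have [Ux|nUx] := pselect (U x); first by left.
    by right.
  + apply: (meager_subset _ mBU) => x [/interior_subset nUx nBx].
    by split=> //; apply: contrapT => nB; apply: nBx; split.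
- move=> B /choice[U UP]; exists (\bigcup_n U n); split.
  + by apply: bigcup_open => n _; have [] := UP n.
  + apply: (@meager_subset _ (\bigcup_n (B n `\` U n))); last first.
      by apply: meager_bigcup => n; have [] := UP n.
    by move=> x [[n _ Bx] nUx]; exists n => //; split=> // Ux; apply: nUx; exists n.
  + apply: (@meager_subset _ (\bigcup_n (U n `\` B n))); last first.
      by apply: meager_bigcup => n; have [] := UP n.
    by move=> x [[n _ Bx] nUx]; exists n => //; split=> // Ux; apply: nUx; exists n.
Qed.


Lemma meager_shift M x : meager M -> meager [set y | M (y + x)].
Proof.
move=> [F [Fnd ->]]; apply/meagerP; exists (fun n => [set y | F n (y + x)]) => [n|y//].
exact: nowhere_dense_shift.
Qed.

(** Fix a step [d] so small that [n] terms started in the left half of [`]a, b[]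
    stay in [`]a, b[]. A starting point [x] fails only if some [x + k * d] lies
    in the meager exceptional set, so the bad starting points form a countable
    union of translates of a meager set, which cannot fill that left half. *)
Lemma comeager_RAP (T : set R) a b : a < b -> meager (`]a, b[ `\` T) -> RAP T.
Proof.
move=> ab mT N; pose n := N.+3.
have n0 : 0 < n%:R :> R by rewrite ltr0n.
pose d := (b - a) / 2 / n%:R.
have d0 : 0 < d by rewrite !divr_gt0//; lra.
have mbad : meager (\bigcup_k [set y | (`]a, b[ `\` T) (y + k%:R * d)]).
  by apply: meager_bigcup => k; exact: meager_shift.
have [x xab nbad] := Baire_itv mbad (ltac:(lra) : a < (a + b) / 2).
exists n; split; first by rewrite /n -addn3 leq_addr.
exists [set x + k%:R * d | k in `I_n]; split; first by split=> //; exists x, d.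
move=> _ [k /= kn <-]; apply: contrapT => nT; apply: nbad; exists k => //=.
split=> //; rewrite in_itv /=.
have kd0 : 0 <= k%:R * d by rewrite mulr_ge0// ltW.
have : k%:R * d <= (b - a) / 2.
  apply: (@le_trans _ _ (n%:R * d)); first by rewrite ler_pM2r// ler_nat ltnW.
  by rewrite /d mulrC divfK// gt_eqF.
lra.
Qed.

(** * Homeomorphisms of the unit interval and meager sets *)

Lemma unit_homeo_mono (phi : R -> R) : unit_homeo phi ->
  {in `[0, 1] &, {mono phi : x y / x <= y}} \/
  {in `[0, 1] &, {mono phi : x y /~ x <= y}}.
Proof.
move=> [[_ phi_inj _] phiC _].
have phi_inj' : {in `[0, 1] &, injective phi}.
  by move=> x y xI yI; apply: phi_inj; rewrite inE.
have [/le_mono_in phi_mono|/le_nmono_in phi_mono] :=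
  itv_continuous_inj_mono phiC phi_inj'; by [left|right].
Qed.

Lemma unit_homeo_itv (phi : R -> R) x : unit_homeo phi ->
  0 <= x <= 1 -> 0 <= phi x <= 1.
Proof. by move=> [[+ _ _] _ _] => /(_ x); rewrite /= !in_itv. Qed.

Lemma unit_homeo_surj (phi : R -> R) y : unit_homeo phi ->
  0 <= y <= 1 -> exists2 x, 0 <= x <= 1 & phi x = y.
Proof.
move=> [[_ _ +] _ _] yI => /(_ y); rewrite /= in_itv /= => /(_ yI)[x].
by rewrite /= in_itv /=; exists x.
Qed.

(** A gap [`[l, r]] of [F] inside the preimage of [`]a, b[] is carried by the
    monotone map [phi] onto a gap of the image inside [`]a, b[]. *)
Lemma nowhere_dense_homeo (phi : R -> R) F : unit_homeo phi ->
  nowhere_dense F -> nowhere_dense (phi @` (F `&` `[0, 1])).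
Proof.
move=> hphi /nowhere_denseP Fgap; apply/nowhere_denseP => a b ab.
(* Off the unit interval there is nothing to avoid: take the middle third. *)
have [b0|b0] := leP b 0.
  exists (a + (b - a) / 3), (a + 2 * (b - a) / 3); split; [lra..|].
  by move=> y ylr [x [_]]; rewrite /= in_itv /= => /(unit_homeo_itv hphi); lra.
have [a1|a1] := leP 1 a.
  exists (a + (b - a) / 3), (a + 2 * (b - a) / 3); split; [lra..|].
  by move=> y ylr [x [_]]; rewrite /= in_itv /= => /(unit_homeo_itv hphi); lra.
pose c := Num.max a 0; pose d := Num.min b 1.
have [ac c0] : a <= c /\ 0 <= c by rewrite !le_max !lexx orbT.
have [db d1] : d <= b /\ d <= 1 by rewrite !ge_min !lexx orbT.
have cd : c < d by rewrite lt_min !gt_max ab b0 a1 ltr01.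
have [u uI phiu] := unit_homeo_surj hphi (y := c) ltac:(lra).
have [v vI phiv] := unit_homeo_surj hphi (y := d) ltac:(lra).
have [phi_mono|phi_mono] := unit_homeo_mono hphi.
- have le_phi x y : 0 <= x <= 1 -> 0 <= y <= 1 -> (phi x <= phi y) = (x <= y).
    by move=> xI yI; rewrite phi_mono ?in_itv.
  have lt_phi x y : 0 <= x <= 1 -> 0 <= y <= 1 -> (phi x < phi y) = (x < y).
    by move=> xI yI; rewrite !ltNge le_phi.
  have uv : u < v by rewrite -lt_phi// phiu phiv.
  have [l [r [ul lr rv nF]]] := Fgap u v uv.
  exists (phi l), (phi r); split.
  + by rewrite (le_lt_trans ac)// -phiu lt_phi//; lra.
  + by rewrite lt_phi//; lra.
  + by rewrite (lt_le_trans _ db)// -phiv lt_phi//; lra.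
  + move=> y ylr [x [Fx /=]]; rewrite in_itv /= => xI xy; move: ylr Fx.
    rewrite -xy !le_phi//; try lra.
    by move=> /nF.
- have le_phi x y : 0 <= x <= 1 -> 0 <= y <= 1 -> (phi x <= phi y) = (y <= x).
    by move=> xI yI; rewrite phi_mono ?in_itv.
  have lt_phi x y : 0 <= x <= 1 -> 0 <= y <= 1 -> (phi x < phi y) = (y < x).
    by move=> xI yI; rewrite !ltNge le_phi.
  have vu : v < u by rewrite -lt_phi// phiu phiv.
  have [l [r [vl lr ru nF]]] := Fgap v u vu.
  exists (phi r), (phi l); split.
  + by rewrite (le_lt_trans ac)// -phiu lt_phi//; lra.
  + by rewrite lt_phi//; lra.
  + by rewrite (lt_le_trans _ db)// -phiv lt_phi//; lra.
  + move=> y ylr [x [Fx /=]]; rewrite in_itv /= => xI xy; move: ylr Fx.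
    rewrite -xy !le_phi//; try lra.
    by rewrite andbC => /nF.
Qed.

Lemma meager_homeo (phi : R -> R) M : unit_homeo phi ->
  meager M -> meager (phi @` (M `&` `[0, 1])).
Proof.
move=> hphi [F [Fnd ->]]; apply/meagerP.
exists (fun n => phi @` (F n `&` `[0, 1])) => [n|]; first exact: nowhere_dense_homeo.
by move=> _ [x [[n _ Fx] xI] <-]; exists n => //; exists x.
Qed.

Lemma baire_property_comeager_itv S : baire_property S -> ~ meager S ->
  exists a b, a < b /\ meager (`]a, b[ `\` S).
Proof.
move=> [U [Uop mSU mUS]] nmS.
have [x Ux] : U !=set0.
  by apply/set0P/negP => /eqP U0; apply: nmS; rewrite -(setD0 S) -U0.
have /nbhs_ballP[e /= e0 xe] : nbhs x U by exact: open_nbhs_nbhs.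
exists (x - e), (x + e); split; first lra.
apply: (meager_subset _ mUS); apply: setSD => y; rewrite /= in_itv /= => xy.
by apply: xe; rewrite /ball /= ltr_norml; lra.
Qed.

(** By the Baire property [S] is comeager in some interval, and one whose
    endpoints [u] and [v] belong to [S] lies in the unit interval. The image of
    that interval is an interval in which [phi @` S] is comeager. *)
Lemma nonmeager_RAP S (phi : R -> R) : S `<=` `[0, 1] -> borel S -> ~ meager S ->
  unit_homeo phi -> RAP (phi @` S).
Proof.
move=> S01 /borel_baire_property bpS nmS hphi.
have [a [b [ab mS]]] := baire_property_comeager_itv bpS nmS.
have inS u v : a <= u -> u < v -> v <= b -> exists2 x, u < x < v & S x.
  move=> au uv vb; have [x xuv nbad] := Baire_itv mS uv.
  exists x => //; apply: contrapT => nSx; apply: nbad; split=> //.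
  by rewrite /= in_itv /=; lra.
have [u uab Su] := inS a b (lexx _) ab (lexx _).
have [v vub Sv] := inS u b ltac:(lra) ltac:(lra) (lexx _).
have := S01 u Su; have := S01 v Sv; rewrite /= !in_itv /= => vI uI.
have puI := unit_homeo_itv hphi uI; have pvI := unit_homeo_itv hphi vI.
have mphi := meager_homeo hphi mS.
have key c d : 0 <= c <= 1 -> 0 <= d <= 1 -> c < d ->
    (forall x, 0 <= x <= 1 -> c < phi x < d -> u < x < v) -> RAP (phi @` S).
  move=> cI dI cd cduv; apply: (comeager_RAP cd); apply: (meager_subset _ mphi).
  move=> y [/=]; rewrite in_itv /= => ycd.
  have [x xI xy] := unit_homeo_surj hphi (y := y) ltac:(lra); rewrite -xy in ycd *.
  have xuv := cduv x xI ycd => nSx; exists x => //; split; last by rewrite /= in_itv.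
  split; first by rewrite /= in_itv /=; lra.
  by move=> Sx; apply: nSx; exists x.
have [phi_mono|phi_mono] := unit_homeo_mono hphi.
- have lt_phi x y : 0 <= x <= 1 -> 0 <= y <= 1 -> (phi x < phi y) = (x < y).
    by move=> xI yI; rewrite !ltNge phi_mono ?in_itv.
  apply: (key (phi u) (phi v)) => // [|x xI]; last by rewrite !lt_phi.
  by rewrite lt_phi//; lra.
- have lt_phi x y : 0 <= x <= 1 -> 0 <= y <= 1 -> (phi x < phi y) = (y < x).
    by move=> xI yI; rewrite !ltNge phi_mono ?in_itv.
  apply: (key (phi v) (phi u)) => // [|x xI]; last by rewrite !lt_phi// andbC.
  by rewrite lt_phi//; lra.
Qed.

End category.

(** * Staircase functions *)

Section staircase.
Context {R : realType}.
Implicit Types (l r x y : R).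

Definition ramp l r x := Num.max 0 (Num.min 1 ((x - l) / (r - l))).

Lemma ramp_le l r x y : l < r -> x <= y -> ramp l r x <= ramp l r y.
Proof.
move=> lr xy; have rl0 : 0 < r - l by rewrite subr_gt0.
have : (x - l) / (r - l) <= (y - l) / (r - l) by rewrite ler_pM2r ?invr_gt0// lerB.
by rewrite /ramp /Num.max /Num.min => ?; case: (ltP 1 ((x - l) / _)) => ?;
  case: (ltP 1 ((y - l) / _)) => ?; do ?[case: ltP => ?]; lra.
Qed.

Lemma ramp0 l r x : l < r -> x <= l -> ramp l r x = 0.
Proof.
move=> lr xl; rewrite /ramp.
have : (x - l) / (r - l) <= 0 by rewrite ler_pdivrMr ?subr_gt0// mul0r subr_le0.
by rewrite /Num.max /Num.min => ?; case: (ltP 1 ((x - l) / _)) => ?;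
  do ?[case: ltP => ?]; lra.
Qed.

Lemma ramp1 l r x : l < r -> r <= x -> ramp l r x = 1.
Proof.
move=> lr xl; rewrite /ramp.
have : 1 <= (x - l) / (r - l) by rewrite ler_pdivlMr ?subr_gt0// mul1r lerB.
by rewrite /Num.max /Num.min => ?; case: (ltP 1 ((x - l) / _)) => ?;
  do ?[case: ltP => ?]; lra.
Qed.

Lemma ramp_lipschitz l r x y : l < r ->
  `|ramp l r x - ramp l r y| <= (r - l)^-1 * `|x - y|.
Proof.
move=> lr; rewrite /ramp; have rl0 : 0 < r - l by rewrite subr_gt0.
have -> : (r - l)^-1 * `|x - y| = `|(x - l) / (r - l) - (y - l) / (r - l)|.
  rewrite -mulrBl normrM (gtr0_norm (_ : 0 < (r - l)^-1)) ?invr_gt0// mulrC.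
  by congr (`|_| * _); ring.
set u := (x - l) / _; set v := (y - l) / _.
rewrite ler_norml.
have := ler_norm (u - v); have := ler_norm (v - u); rewrite (distrC v).
by rewrite /Num.max /Num.min => ? ?; case: (ltP 1 u) => ?; case: (ltP 1 v) => ?;
  do ?[case: ltP => ?]; lra.
Qed.

Variables (N : nat) (t l r : nat -> R).
Hypothesis lr : forall i, [/\ t i < l i, l i < r i & r i < t i.+1].

(** The continuous function that climbs from [A i] to [A i.+1] on
    [`[l i, r i]] and is constant between consecutive ramps. *)
Definition stair (A : nat -> R) x :=
  A 0%N + \sum_(i < N) (A i.+1 - A i) * ramp (l i) (r i) x.

Lemma stair_step A x m : (m <= N)%N ->
  (forall i, (i < m)%N -> r i <= x) ->
  (forall i, (m <= i < N)%N -> x <= l i) -> stair A x = A m.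
Proof.
move=> mN r_le le_l; rewrite /stair.
rewrite -(big_mkord xpredT (fun i => (A i.+1 - A i) * ramp (l i) (r i) x)).
rewrite (big_cat_nat (n := m))//= [X in _ + (_ + X)]big_nat_cond.
rewrite [X in _ + (_ + X)]big1 => [|i]; last first.
  by rewrite andbT => imN; have [_ ? _] := lr i; rewrite ramp0 ?mulr0// le_l.
rewrite big_nat_cond (eq_bigr (fun i => A i.+1 - A i)) => [|i]; last first.
  by rewrite andbT => im; have [_ ? _] := lr i; rewrite ramp1 ?mulr1// r_le.
by rewrite -big_nat_cond telescope_sumr// addr0 addrC subrK.
Qed.

Lemma stair_le A x y : (forall i, (i < N)%N -> A i <= A i.+1) ->
  x <= y -> stair A x <= stair A y.
Proof.
move=> A_le xy; rewrite lerD2l; apply: ler_sum => i _.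
rewrite ler_wpM2l ?subr_ge0 ?A_le//.
by apply: ramp_le => //; have [] := lr i.
Qed.

Lemma stair_lipschitz A : exists2 C, 0 < C &
  forall x y, `|stair A x - stair A y| <= C * `|x - y|.
Proof.
exists (1 + \sum_(i < N) `|A i.+1 - A i| * (r i - l i)^-1).
  rewrite ltr_pwDl// sumr_ge0// => i _; rewrite mulr_ge0// invr_ge0 subr_ge0.
  by have [_ /ltW] := lr i.
move=> x y; rewrite /stair opprD addrACA subrr add0r -sumrB mulrDl mul1r ler_wpDl//.
rewrite mulr_suml; apply: le_trans (ler_norm_sum _ _ _) _.
apply: ler_sum => i _; rewrite -mulrBr normrM -mulrA ler_wpM2l//.
by apply: ramp_lipschitz; have [] := lr i.
Qed.

Lemma t_le i j : (i <= j)%N -> t i <= t j.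
Proof.
move=> ij; rewrite -(subnK ij); elim: (j - i)%N => // k; rewrite addSn => /le_trans; apply.
by have [? ? ?] := lr (k + i); lra.
Qed.

Lemma stair_grid A j x : (j <= N)%N -> x = t j -> stair A x = A j.
Proof.
move=> jN ->; apply: stair_step => // i.
- by move=> /t_le; have [? ? ?] := lr i; lra.
- by move=> /andP[/t_le + _]; have [? ? ?] := lr i; lra.
Qed.

(** Only the levels [A j] are taken off the ramps, so on a set that the ramps
    avoid the arithmetic of the staircase is that of the sequence [A]. *)
Lemma stair_off_ramp A j x : (j < N)%N -> t j <= x <= t j.+1 ->
  ~ (l j <= x <= r j) ->
  stair A x = A j \/ stair A x = A j.+1.
Proof.
move=> jN tx nlr; have [xl|lx] := leP x (l j).
- left; apply: stair_step => [|i|i]; first exact: ltnW.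
  + by move=> /t_le; have [? ? ?] := lr i; lra.
  + move=> /andP[]; rewrite leq_eqVlt => /predU1P[<- //|/t_le + _].
    by have [? ? ?] := lr i; lra.
- have rx : r j < x by rewrite ltNge; apply/negP => ?; apply: nlr; rewrite ltW.
  right; apply: stair_step => // [i|i].
  + rewrite ltnS leq_eqVlt => /predU1P[->|/t_le]; first exact: ltW.
    by have [? ? ?] := lr i; lra.
  + by move=> /andP[/t_le + _]; have [? ? ?] := lr i; lra.
Qed.

End staircase.

(** * Separating perturbations *)

Section perturbation.
Context {R : realType}.
Implicit Types (f g h : R -> R) (x y z e delta : R) (S : set R).

Definition nondec01 f := forall x y, 0 <= x -> x <= y -> y <= 1 -> f x <= f y.

(** The bounds are non-strict so that the property passes to uniform limits by
    adding inequalities. *)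
Definition ucont01 f := forall e, 0 < e -> exists2 d, 0 < d &
  forall x y, 0 <= x <= 1 -> 0 <= y <= 1 -> `|x - y| <= d -> `|f x - f y| <= e.

Definition close01 e f g := forall x, 0 <= x <= 1 -> `|f x - g x| <= e.

(** The two properties wanted of the limit, strict monotonicity and absence of
    three-term progressions in the image of [S], restricted to points at mutual
    distance at least [delta]. At a fixed scale they can be made stable under
    small uniform perturbations. *)
Definition separates delta S h :=
  (forall x y, 0 <= x -> y <= 1 -> x + delta <= y -> h x < h y) /\
  (forall x y z, S x -> S y -> S z -> 0 <= x -> z <= 1 ->
    x + delta <= y -> y + delta <= z -> h x + h z != 2 * h y).

(** Each condition excludes a single value of [s]. *)
Lemma small_perturbation (I : finType) (P : pred I) (p q : I -> R) e : 0 < e ->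
  (forall i, P i -> q i != 0) ->
  exists2 s, 0 < s <= e & forall i, P i -> p i + s * q i != 0.
Proof.
move=> e0 q_neq0.
have : \forall s \near (0 : R)^'+, forall i, P i -> p i + s * q i != 0.
  apply: filter_forall => i; have [Pi|nPi] := boolP (P i); last exact: nearW.
  have qi0 := q_neq0 i Pi.
  have : \forall s \near (0 : R)^'+, s != - p i / q i.
    have [c0|c0] := ltP 0 (- p i / q i).
      by apply: filterS (nbhs_right_lt c0) => s /lt_eqF ->.
    by apply: filterS (nbhs_right_gt 0) => s s0; rewrite gt_eqF// (le_lt_trans c0).
  apply: filterS => s sc _; apply: contra_neq sc => /eqP.
  by rewrite addr_eq0 => /eqP ->; rewrite opprK mulfK.
move=> /(filterI (filterI (nbhs_right_gt 0) (nbhs_right_le e0))) /filter_ex.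
by move=> [s [[s0 se] sP]]; exists s => //; rewrite s0.
Qed.

Lemma uniform_lower_bound (I : finType) (P : pred I) (p : I -> R) e : 0 < e ->
  (forall i, P i -> p i != 0) ->
  exists2 s, 0 < s <= e & forall i, P i -> s <= `|p i|.
Proof.
move=> e0 p_neq0.
have : \forall s \near (0 : R)^'+, forall i, P i -> s <= `|p i|.
  apply: filter_forall => i; have [Pi|nPi] := boolP (P i); last exact: nearW.
  have pi0 : 0 < `|p i| by rewrite normr_gt0 p_neq0.
  by apply: filterS (nbhs_right_le pi0) => s.
move=> /(filterI (filterI (nbhs_right_gt 0) (nbhs_right_le e0))) /filter_ex.
by move=> [s [[s0 se] sP]]; exists s => //; rewrite s0.
Qed.

Lemma invS_le e : 0 < e -> exists n : nat, n.+1%:R^-1 <= e.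
Proof.
move=> e0; exists (Num.truncn e^-1).
by rewrite -[leRHS]invrK lef_pV2 ?posrE ?invr_gt0// ltW// truncnS_gt.
Qed.

Lemma cell_exists N x : (0 < N)%N -> 0 <= x <= 1 ->
  exists2 j, (j < N)%N & j%:R / N%:R <= x <= j.+1%:R / N%:R.
Proof.
move=> N0 /andP[x0 x1].
suff cell m : (0 < m)%N -> x <= m%:R / N%:R ->
    exists2 j, (j < m)%N & j%:R / N%:R <= x <= j.+1%:R / N%:R.
  by apply: cell => //; rewrite divff// pnatr_eq0 -lt0n.
elim: m => // m IH _ xm.
have [x_le|lt_x] := leP x (m%:R / N%:R); last by exists m => //; rewrite xm ltW.
case: m => [|m] in IH xm x_le *.
  by exists 0%N => //; rewrite xm mul0r x0.
by have [//|//|j jm xj] := IH; exists j => //; rewrite ltnW.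
Qed.

(** The heart of the construction. On a fine grid, [f] is uniformly close to the
    staircase with levels [f (t i)] whose ramps are placed in gaps of [S]. Such
    a staircase takes finitely many values on [S], and points of [S] at distance
    at least [delta] lie on different steps, so only finitely many relations
    [A i + A k = 2 * A j] with [i < j < k] have to be destroyed. Adding the
    strictly convex sequence [s * 2 ^ i] to the levels does so for all small
    [s > 0] but finitely many, and makes the levels strictly increasing. What
    remains is a finite set of nonzero quantities, bounded away from zero, which
    gives the margin [eta]. *)
Lemma perturb_separates f S e delta : nondec01 f -> ucont01 f -> nowhere_dense S ->
    0 < e -> 0 < delta ->
  exists g eta, [/\ nondec01 g, ucont01 g, 0 < eta, close01 e g f &
    forall h, close01 eta h g -> separates delta S h].
Proof.
move=> f_le f_uc Snd e0 delta0.
have e40 : 0 < e / 4 by lra.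
have [d d0 fd] := f_uc _ e40.
have [N [N0 Nd Ndelta]] : exists N, [/\ (0 < N)%N, N%:R^-1 <= d & N%:R^-1 * 3 <= delta].
  pose m := Num.min d (delta / 3).
  have m0 : 0 < m by rewrite lt_min d0 divr_gt0.
  have [k km] := invS_le m0; exists k.+1; split=> //.
    by rewrite (le_trans km)// ge_min lexx.
  by rewrite -ler_pdivlMr// (le_trans km)// ge_min lexx orbT.
pose t i : R := i%:R / N%:R.
have NR0 : 0 < N%:R :> R by rewrite ltr0n.
have tS i : t i.+1 = t i + N%:R^-1 by rewrite /t -addn1 natrD mulrDl mul1r.
have iN0 : 0 < N%:R^-1 :> R by rewrite invr_gt0.
have t0 i : 0 <= t i by rewrite divr_ge0.
have t1 i : (i <= N)%N -> t i <= 1 by move=> iN; rewrite ler_pdivrMr// mul1r ler_nat.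
have /choice[lr lrP] : forall i, exists p : R * R,
    [/\ t i < p.1, p.1 < p.2, p.2 < t i.+1 & forall x, p.1 <= x <= p.2 -> ~ S x].
  move=> i.
  move/nowhere_denseP : Snd => /(_ (t i) (t i.+1)) [|a [b abP]].
    by rewrite tS ltrDl.
  by exists (a, b).
pose l i := (lr i).1; pose r i := (lr i).2.
have tlr i : [/\ t i < l i, l i < r i & r i < t i.+1] by have [] := lrP i.
pose I := ('I_N.+1 * 'I_N.+1 * 'I_N.+1)%type.
pose ordered (v : I) := ((v.1.1 < v.1.2) && (v.1.2 < v.2))%N.
pose D (a : nat -> R) (v : I) := a v.1.1 + a v.2 - 2 * a v.1.2.
pose pow2 i : R := 2 ^+ i.
(* For i < j < k one has 2 ^ k >= 2 * 2 ^ j, and 2 ^ i is left over. *)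
have pow2_convex v : ordered v -> D pow2 v != 0.
  move=> /andP[ij jk]; rewrite gt_eqF// /D /pow2.
  have : 2 ^+ v.1.2.+1 <= 2 ^+ v.2 :> R by rewrite ler_weXn2l// ler1n.
  have : 0 < 2 ^+ v.1.1 :> R by rewrite exprn_gt0.
  by rewrite exprS; lra.
have eN0 : 0 < e / 4 / pow2 N by rewrite divr_gt0// exprn_gt0.
have [s /andP[s0 sN] sP] :=
  small_perturbation (D (f \o t)) eN0 pow2_convex.
pose A i := f (t i) + s * pow2 i.
have AP v : ordered v -> D A v != 0.
  move=> /sP; congr (_ != 0); rewrite /D /A /=; ring.
have s2N : s * pow2 N <= e / 4 by rewrite -ler_pdivlMr// exprn_gt0.
have s2i i : (i <= N)%N -> 0 <= s * pow2 i <= e / 4.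
  move=> iN; rewrite mulr_ge0 ?exprn_ge0 ?(ltW s0)//=.
  rewrite (le_trans _ s2N)// ler_wpM2l ?(ltW s0)//.
  by rewrite ler_weXn2l// ler1n.
have A_lt i : (i < N)%N -> A i + s <= A i.+1.
  move=> iN; have : f (t i) <= f (t i.+1).
    by apply: f_le => //; [rewrite tS lerDl ltW|exact: t1].
  rewrite /A /pow2 exprS.
  have : s * 1 <= s * 2 ^+ i by rewrite ler_wpM2l ?(ltW s0)// exprn_ege1// ler1n.
  lra.
have A_le i : (i < N)%N -> A i <= A i.+1 by move=> /A_lt; lra.
have [eta /andP[eta0 eta_s] etaP] := uniform_lower_bound s0 AP.
pose g := stair N l r A.
have g_grid i : (i <= N)%N -> g (t i) = A i by move=> iN; exact: (stair_grid tlr).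
have g_le x y : x <= y -> g x <= g y by exact: (stair_le tlr).
(* A change of at most eta / 5 moves x + z - 2 y by at most 4/5 of the margin. *)
exists g, (eta / 5); split.
- by move=> x y _ /g_le.
- have [C C0 gC] := stair_lipschitz N tlr A.
  move=> e' e'0; exists (e' / C); first by rewrite divr_gt0.
  move=> x y _ _; rewrite ler_pdivlMr// mulrC => ?.
  exact: le_trans (gC _ _) _.
- by rewrite divr_gt0.
- move=> x xI; have [j jN /andP[jx xj]] := cell_exists N0 xI.
  have := g_le _ _ jx; have := g_le _ _ xj; rewrite -/(t j) -/(t j.+1).
  rewrite !g_grid// 1?ltnW// /A.
  have := s2i j (ltnW jN); have := s2i j.+1 jN.
  have tjI : 0 <= t j <= 1 by rewrite t0 t1// ltnW.
  have tj1I : 0 <= t j.+1 <= 1 by rewrite t0 t1.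
  have := tS j; rewrite -/(t j) -/(t j.+1) in jx xj * => tSj.
  have := fd (t j) x tjI xI; have := fd (t j.+1) x tj1I xI.
  rewrite !ler_norml => h1 h2 h3 h4 h5 h6.
  have {}h1 := h1 ltac:(lra); have {}h2 := h2 ltac:(lra); lra.
- move=> h hg; have hgI x : 0 <= x <= 1 -> g x - eta / 5 <= h x <= g x + eta / 5.
    by move=> /hg; rewrite ler_norml; lra.
  split=> [x y x0 y1 xy|x y z Sx Sy Sz x0 z1 xy yz].
  + have [j jN /andP[jx xj]] := cell_exists N0 (ltac:(lra) : 0 <= x <= 1).
    rewrite -/(t j) -/(t j.+1) in jx xj.
    have j1N : (j.+2 <= N)%N.
      have : t j.+2 <= t N by rewrite [t N]divff ?gt_eqF// !tS; move: (tS j); lra.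
      by rewrite /t ler_pM2r// ler_nat.
    have := hgI x ltac:(lra); have := hgI y ltac:(lra).
    have := g_le _ _ xj; have /g_le : t j.+2 <= y by rewrite !tS; move: (tS j); lra.
    rewrite !g_grid//.
    have := A_lt _ j1N; lra.
  + have level w : S w -> 0 <= w <= 1 ->
        exists2 m : 'I_N.+1, g w = A m & t m - N%:R^-1 <= w <= t m + N%:R^-1.
      move=> Sw wI; have [j jN jw] := cell_exists N0 wI.
      rewrite -/(t j) -/(t j.+1) in jw.
      have nlr : ~ (l j <= w <= r j) by have [_ _ _ nS] := lrP j; move=> /nS.
      have [gw|gw] := stair_off_ramp tlr A jN jw nlr.
      * exists (Ordinal (ltnW jN : (j < N.+1)%N)) => //=.
        by move: jw; rewrite tS; lra.
      * exists (Ordinal (jN : (j.+1 < N.+1)%N)) => //=.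
        by move: jw; rewrite tS; lra.
    have t_lt m n : t m < t n -> (m < n)%N by rewrite /t ltr_pM2r// ltr_nat.
    have [i gx xi] := level x Sx ltac:(lra).
    have [j gy yj] := level y Sy ltac:(lra).
    have [k gz zk] := level z Sz ltac:(lra).
    have ijk : ordered (i, j, k) by apply/andP; split; apply: t_lt; lra.
    have := etaP _ ijk; rewrite /D /= -gx -gy -gz.
    have := hgI x ltac:(lra); have := hgI y ltac:(lra); have := hgI z ltac:(lra).
    move=> hz hy hx eta_le; apply/eqP => hh.
    have : `|g x + g z - 2 * g y| <= 4 * (eta / 5) by rewrite ler_norml; lra.
    lra.
Qed.

End perturbation.

(** * The limit homeomorphism *)

Section limit.
Context {R : realType}.
Implicit Types (f g h phi : R -> R) (x y z e delta : R) (S : set R).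

Lemma nowhere_dense_initial_union (F : nat -> set R) n :
  (forall k, nowhere_dense (F k)) -> nowhere_dense (\bigcup_(k < n) F k).
Proof.
move=> Fnd; elim: n => [|n IH].
  by rewrite bigcup_mkord big_ord0; exact: nowhere_dense0.
apply/nowhere_denseP => a b ab.
have [l [r [al lr rb nF]]] := (nowhere_denseP _).1 IH a b ab.
have [l' [r' [ll' lr' rr' nFn]]] := (nowhere_denseP _).1 (Fnd n) l r lr.
exists l', r'; split; [lra..|] => x xlr [k /=]; rewrite ltnS leq_eqVlt.
move=> /predU1P[->|kn Fkx]; first exact: nFn.
by apply: (nF x ltac:(lra)); exists k.
Qed.

(** A Baire category argument in the space of nondecreasing continuous
    functions, carried out by hand: the functions that separate [K n] at scale
    [delta n] contain a dense open set, and the limit of a sequence of nested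
    balls lies in all of these sets. *)
Lemma limit_of_perturbations (K : nat -> set R) (delta : nat -> R) :
  (forall n, nowhere_dense (K n)) -> (forall n, 0 < delta n) ->
  exists f, [/\ nondec01 f, ucont01 f & forall n, separates (delta n) (K n) f].
Proof.
move=> Knd delta0.
pose good (p : (R -> R) * R) := [/\ nondec01 p.1, ucont01 p.1 & 0 < p.2].
have step (np : nat * ((R -> R) * R)) : exists q, good np.2 ->
    [/\ good q, close01 (np.2.2 - q.2) q.1 np.2.1, q.2 <= np.1.+1%:R^-1 &
      forall h, close01 q.2 h q.1 -> separates (delta np.1) (K np.1) h].
  case: np => n [f e] /=; have [[/= f_le f_uc e0]|nfe] := pselect (good (f, e)); last first.
    by exists (f, e).
  have e20 : 0 < e / 2 by lra.
  have [g [eta [g_le g_uc eta0 gf sep]]] :=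
    perturb_separates f_le f_uc (Knd n) e20 (delta0 n).
  pose e' := Num.min eta (Num.min (e / 2) n.+1%:R^-1).
  have [e'eta e'e e'n] : [/\ e' <= eta, e' <= e / 2 & e' <= n.+1%:R^-1].
    by rewrite !ge_min !lexx !orbT.
  exists (g, e') => _; split => //=.
  - by split=> //=; rewrite !lt_min eta0 e20 invr_gt0 ltr0n.
  - by move=> x /gf; lra.
  - by move=> h hg; apply: sep => x /hg; lra.
have [nxt nxtP] := choice step.
pose u := fix u n := if n is m.+1 then nxt (m, u m) else (id, 1).
have u_good n : good (u n).
  elim: n => [|n IH] /=; last by have [] := nxtP (n, u n) IH.
  split=> //= e e0; first by exists e.
have uP n : [/\ good (u n.+1), close01 ((u n).2 - (u n.+1).2) (u n.+1).1 (u n).1,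
    (u n.+1).2 <= n.+1%:R^-1 &
    forall h, close01 (u n.+1).2 h (u n.+1).1 -> separates (delta n) (K n) h].
  exact: nxtP (n, u n) (u_good n).
move: u u_good uP => u u_good uP.
(* Successive balls are nested: the radius drops by at least the displacement
   of the centre. *)
have u_cauchy n m x : (n <= m)%N -> 0 <= x <= 1 ->
    `|(u m).1 x - (u n).1 x| <= (u n).2 - (u m).2.
  move=> nm xI; rewrite -(subnK nm); elim: (m - n)%N => [|k IH].
    by rewrite !subrr normr0.
  have [_ /(_ x xI)] := uP (k + n)%N; rewrite addSn => + _ _.
  by move: IH; rewrite !ler_norml; lra.
have u_pos n : 0 < (u n).2 by have [] := u_good n.
(* The common point of the nested segments of centre u_n(x) and radius e_n. *)
pose f x := sup (range (fun n => (u n).1 x - (u n).2)).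
have ub x n : 0 <= x <= 1 ->
    ubound (range (fun n => (u n).1 x - (u n).2)) ((u n).1 x + (u n).2).
  move=> xI _ [m _ <-]; have := u_pos n; have := u_pos m.
  have [/u_cauchy/(_ xI)|/ltnW/u_cauchy/(_ xI)] := leqP n m; rewrite ler_norml; lra.
have f_lb x n : 0 <= x <= 1 -> (u n).1 x - (u n).2 <= f x.
  by move=> xI; apply: ub_le_sup; [exists ((u 0).1 x + (u 0).2); exact: ub|exists n].
have f_ub x c : 0 <= x <= 1 -> (forall n, (u n).1 x - (u n).2 <= c) -> f x <= c.
  move=> xI fc; apply: ge_sup; first by exists ((u 0).1 x - (u 0).2), 0%N.
  by move=> _ [n _ <-].
have f_close n : close01 (u n).2 f (u n).1.
  move=> x xI; rewrite ler_norml.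
  have := f_lb x n xI; have : f x <= (u n).1 x + (u n).2; last lra.
  by apply: f_ub => // m; apply: ub => //; exists m.
exists f; split.
- move=> x y x0 xy y1; apply: f_ub => [|n]; first lra.
  have [u_le _ _] := u_good n; apply: le_trans (f_lb y n _); last lra.
  by rewrite lerD2r u_le.
- move=> e e0; have [n ne] := invS_le (ltac:(lra) : 0 < e / 3).
  have [_ _ un _] := uP n; have [_ + _] := u_good n.+1.
  move=> /(_ (e / 3) ltac:(lra))[d d0 ud]; exists d => // x y xI yI xy.
  have := ud x y xI yI xy; have := f_close n.+1 x xI; have := f_close n.+1 y yI.
  have := le_trans un ne; rewrite !ler_norml; lra.
- by move=> n; have [_ _ _] := uP n; apply; exact: (f_close n.+1).
Qed.

Lemma ucont01_continuous f : ucont01 f -> {within `[0, 1], continuous f}.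
Proof.
move=> f_uc; apply/subspace_continuousP => x xI.
apply/cvgrPdist_le => e e0; have [d d0 fd] := f_uc e e0.
rewrite near_withinE; near=> y => yI; apply: fd.
- by move: xI; rewrite /= in_itv.
- by move: yI; rewrite /= in_itv.
- near: y; exact: cvgr_dist_le.
Unshelve. all: by end_near. Qed.

Lemma increasing_unit_homeo phi : ucont01 phi ->
  (forall x y, 0 <= x -> x < y -> y <= 1 -> phi x < phi y) ->
  phi 0 = 0 -> phi 1 = 1 -> unit_homeo phi.
Proof.
move=> /ucont01_continuous phiC phi_lt phi0 phi1.
have phi_le x y : 0 <= x <= 1 -> 0 <= y <= 1 -> x <= y -> phi x <= phi y.
  by move=> ? ?; rewrite le_eqVlt => /predU1P[-> //|?]; apply/ltW/phi_lt; lra.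
have phi_inj : {in `[0, 1] &, injective phi}.
  move=> x y; rewrite !in_itv /= => xI yI phixy; apply: contrapT => /eqP.
  by rewrite neq_lt => /orP[xy|yx]; [have := phi_lt x y|have := phi_lt y x]; lra.
have phi_surj : set_surj `[0, 1] `[0, 1] phi.
  have := @segment_continuous_le_surjective _ 0 1 phi ler01.
  by rewrite phi0 phi1; apply.
have /choice[g gP] y : exists x, 0 <= y <= 1 -> 0 <= x <= 1 /\ phi x = y.
  have [yI|nyI] := pselect (is_true (0 <= y <= 1)); last by exists 0.
  have := phi_surj y; rewrite /= in_itv /= => /(_ yI)[x].
  by rewrite /= in_itv /=; exists x.
have phiI x : 0 <= x <= 1 -> 0 <= phi x <= 1.
  by move=> xI; have := phi_le 0 x; have := phi_le x 1; lra.
have phiK : {in `[0, 1], cancel phi g}.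
  move=> x; rewrite in_itv /= => xI.
  by have [gI gphi] := gP _ (phiI _ xI); apply: phi_inj; rewrite ?in_itv.
split=> //.
- by split=> // x y; rewrite !inE; exact: phi_inj.
- exists g; split=> //.
  by have := segment_can_le_continuous ler01 phiC phiK; rewrite phi0 phi1.
Qed.

(** With [S] exhausted by an increasing sequence of nowhere dense sets, any three
    points of [S] are seen together at a late enough stage, at a scale below
    their gaps. The limit function is then made to fix 0 and 1 by an affine
    change of values, which preserves arithmetic progressions. *)
Lemma meager_FAP S : S `<=` `[0, 1] -> meager S ->
  exists phi, unit_homeo phi /\ FAP (phi @` S).
Proof.
move=> S01 [F [Fnd SF]].
have [f [f_le f_uc sep]] : exists f, [/\ nondec01 f, ucont01 f &
    forall n, separates n.+1%:R^-1 (\bigcup_(k < n) F k) f].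
  apply: limit_of_perturbations => n; first exact: nowhere_dense_initial_union.
  by rewrite invr_gt0 ltr0n.
have f_lt x y : 0 <= x -> x < y -> y <= 1 -> f x < f y.
  move=> x0 xy y1; have [n ne] := invS_le (ltac:(lra) : 0 < y - x).
  by have [+ _] := sep n; apply => //; rewrite addrC -lerBrDr.
have f01 : 0 < f 1 - f 0 by rewrite subr_gt0 f_lt.
pose phi x := (f x - f 0) / (f 1 - f 0).
have phi_lt x y : 0 <= x -> x < y -> y <= 1 -> phi x < phi y.
  by move=> x0 xy y1; rewrite ltr_pM2r ?invr_gt0// ltrD2r f_lt.
have SI x : S x -> 0 <= x <= 1 by move=> /S01; rewrite /= in_itv.
exists phi; split.
  apply: increasing_unit_homeo => //; last 2 first.
  - by rewrite /phi subrr mul0r.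
  - by rewrite /phi divff// gt_eqF.
  move=> e e0; have [d d0 fd] := f_uc _ (mulr_gt0 e0 f01); exists d => // x y xI yI xy.
  rewrite -mulrBl normrM [X in _ * X]gtr0_norm ?invr_gt0// ler_pdivrMr//.
  by rewrite opprB addrA subrK; exact: fd.
(* A progression in the image comes from points a < b < c of S with
   f a + f c = 2 * f b. *)
move=> [_ [[_ [x [d [d0 ->]]]] sub]].
have [a Sa phia] := sub (x + 0%:R * d) ltac:(by exists 0%N).
have [b Sb phib] := sub (x + 1%:R * d) ltac:(by exists 1%N).
have [c Sc phic] := sub (x + 2%:R * d) ltac:(by exists 2%N).
have lt_of_phi y z : S y -> S z -> phi y < phi z -> y < z.
  move=> /SI yI /SI zI; rewrite !ltNge; apply: contra.
  rewrite le_eqVlt => /predU1P[-> //|zy]; apply/ltW/phi_lt; lra.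
have ab : a < b by apply: lt_of_phi => //; rewrite phia phib; lra.
have bc : b < c by apply: lt_of_phi => //; rewrite phib phic; lra.
have [i _ Fia] : (\bigcup_n F n) a by rewrite -SF.
have [j _ Fjb] : (\bigcup_n F n) b by rewrite -SF.
have [k _ Fkc] : (\bigcup_n F n) c by rewrite -SF.
have [n0 n0e] := invS_le (ltac:(by rewrite lt_min !subr_gt0 ab) :
  0 < Num.min (b - a) (c - b)).
pose n := (n0 + (i + j + k).+1)%N.
have [ni nj nk] : [/\ i < n, j < n & k < n]%N by rewrite /n; split; lia.
have : n.+1%:R^-1 <= Num.min (b - a) (c - b).
  by apply: le_trans n0e; rewrite lef_pV2 ?posrE ?ltr0n// ler_nat ltnS leq_addr.
rewrite le_min => /andP[nab nbc].
have fE y : f y = f 0 + phi y * (f 1 - f 0) by rewrite /phi divfK ?gt_eqF// addrC subrK.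
have [_ /(_ a b c)] := sep n.
have -> : f a + f c = 2 * f b by rewrite (fE a) (fE b) (fE c) phia phib phic; ring.
have /andP[a0 _] := SI a Sa; have /andP[_ c1] := SI c Sc.
rewrite lerBrDl in nab; rewrite lerBrDl in nbc.
rewrite eqxx => sepn; suff : false by [].
by apply: sepn => //; [exists i|exists j|exists k].
Qed.
End limit.

(** * The dichotomy *)

Lemma RAP_not_FAP (R : realType) (S : set R) : RAP S -> ~ FAP S.
Proof.
move=> /(_ 3%N)[n [n3 [_ [[_ [x [d [d0 ->]]]] sub]]]]; apply.
exists [set x + k%:R * d | k in `I_3]; split; first by split=> //; exists x, d.
move=> _ [k /= k3 <-]; apply: sub; exists k => //=.
exact: leq_trans k3 n3.
Qed.

Theorem theorem1 (R : realType) (S : set R)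
    (S01 : S `<=` `[0, 1]) (borelS : borel S) :
  let assertion1 := exists phi : R -> R, unit_homeo phi /\ FAP (phi @` S) in
  let assertion2 := forall phi : R -> R, unit_homeo phi -> RAP (phi @` S) in
  ((assertion1 \/ assertion2) /\ ~ (assertion1 /\ assertion2)) /\
  (assertion1 <-> meager S).
Proof.
move=> assertion1 assertion2.
have meager1 : meager S -> assertion1 by exact: meager_FAP.
have nonmeager2 : ~ meager S -> assertion2.
  by move=> nmS phi; exact: nonmeager_RAP.
have exclusive : assertion1 -> assertion2 -> False.
  by move=> [phi [hphi +]] => /[swap] /(_ phi hphi) /RAP_not_FAP.
split; first split; last split=> //.
- by have [/meager1|/nonmeager2] := pselect (meager S); [left|right].
- by move=> [/exclusive].
- by move=> a1; apply: contrapT => /nonmeager2; exact: exclusive.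
Qed.
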